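(* Let $(T_i)_{0\leq i\leq k}$ be a geodesic path and $(T'_i)_{0\leq i\leq l}$ a path of triangulations of the same convex polygon such that $T_0=T'_0$. If, for some $j\in\{0,\dots,k\}$, the triangulation $T_j$ contains all the edges introduced along the path $(T'_i)_{0\leq i\leq l}$, then the triangulations $T'_l$ and $T_k$ have flip distance $k-l$.
   Context: An edge on a convex polygon is a set of two of its vertices; two edges cross if they are disjoint but their convex hulls intersect. A triangulation of a convex polygon is an inclusion-maximal set of pairwise non-crossing edges. For an interior (non-boundary) edge $\varepsilon$ of a triangulation $T$, $\varepsilon$ is a diagonal of a unique quadrilateral whose four sides lie in $T$; replacing $\varepsilon$ by the other diagonal is a flip, which removes $\varepsilon$ and introduces the other diagonal. A path of length $k$ from $U$ to $V$ is a sequence $U=T_0,\dots,T_k=V$ in which $T_{i+1}$ is obtained from $T_i$ by a flip; the edges introduced along the path are those introduced by its flips. A path is geodesic if its length is minimal among paths between its endpoints; the flip distance is the length of a geodesic path. *)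

(* Defs.v *)
From mathcomp Require Import all_boot all_order all_algebra.
From mathcomp Require Import reals.

Set Implicit Arguments.
Unset Strict Implicit.
Unset Printing Implicit Defensive.

Import Order.TTheory GRing.Theory Num.Theory.
Local Open Scope ring_scope.

Section ConvexPolygon.
Variables (R : realType) (n : nat) (p : 'I_n -> 'rV[R]_2).

Definition in_hull (A : {set 'I_n}) (x : 'rV[R]_2) : Prop :=
  exists w : 'I_n -> R,
    [/\ forall i, 0 <= w i,
        forall i, i \notin A -> w i = 0,
        \sum_i w i = 1
      & x = \sum_i w i *: p i].

(* The points p i are the vertices of a convex polygon: each is an extreme
   point of the hull of all of them.  In particular they are pairwise distinct,
   so that sets of indices stand for sets of vertices.  The order of the
   indices carries no geometric meaning. *)
Definition convex_polygon : Prop :=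
  (3 <= n)%N /\ forall i, ~ in_hull [set~ i] (p i).

Definition is_edge (e : {set 'I_n}) : Prop := #|e| = 2%N.

Definition cross (e f : {set 'I_n}) : Prop :=
  [disjoint e & f] /\ exists x, in_hull e x /\ in_hull f x.

Definition noncrossing (T : {set {set 'I_n}}) : Prop :=
  (forall e, e \in T -> is_edge e) /\
  (forall e f, e \in T -> f \in T -> ~ cross e f).

Definition triangulation (T : {set {set 'I_n}}) : Prop :=
  noncrossing T /\
  forall S : {set {set 'I_n}}, noncrossing S -> T \subset S -> S = T.

(* T' arises from T by the flip that removes e = ac and introduces f = bd, the
   two diagonals of the quadrilateral with consecutive vertices a, b, c, d.
   Crossing is what makes ac and bd the diagonals; it also forces e to be an
   interior edge, as no edge crosses a boundary edge. *)
Definition flip_edges (T : {set {set 'I_n}}) (e f : {set 'I_n})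
    (T' : {set {set 'I_n}}) : Prop :=
  exists a b c d : 'I_n,
    [/\ uniq [:: a; b; c; d],
        e = [set a; c] /\ f = [set b; d],
        cross e f,
        [/\ e \in T, [set a; b] \in T, [set b; c] \in T,
            [set c; d] \in T & [set d; a] \in T]
      & T' = f |: (T :\ e)].

Definition flip (T T' : {set {set 'I_n}}) : Prop :=
  exists e f, flip_edges T e f T'.

(* Only the values T 0, ..., T k matter in a path of length k. *)
Definition flip_path (k : nat) (T : nat -> {set {set 'I_n}}) : Prop :=
  (forall i, (i <= k)%N -> triangulation (T i)) /\
  (forall i, (i < k)%N -> flip (T i) (T i.+1)).

Definition introduced_along (k : nat) (T : nat -> {set {set 'I_n}})
    (f : {set 'I_n}) : Prop :=
  exists i, (i < k)%N /\ exists e, flip_edges (T i) e f (T i.+1).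

Definition geodesic (k : nat) (T : nat -> {set {set 'I_n}}) : Prop :=
  flip_path k T /\
  forall m (S : nat -> {set {set 'I_n}}),
    flip_path m S -> S 0%N = T 0%N -> S m = T k -> (k <= m)%N.

Definition flip_distance (U V : {set {set 'I_n}}) (d : nat) : Prop :=
  exists T : nat -> {set {set 'I_n}}, [/\ geodesic d T, T 0%N = U & T d = V].

End ConvexPolygon.

(* Main.v *)
(** The heart of the matter is the case [l = 1]: if a flip of [U] into [U']
    introduces an edge [f] of [V], then [U'] is one step closer to [V].  Let [a]
    be an endpoint of [f].  Replacing every edge [uv] that crosses [f] by [au]
    and [av], and adding [f], retracts the triangulations onto those that
    contain [f], and it maps a flip to a flip or to a stationary step.  It sends
    [U] to [U'] and fixes [V], and any path from [U] to [V] has a step that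
    introduces [f], which becomes stationary.

    Crossings are handled by ranking the vertices by angle around [a]: two edges
    cross exactly when their ranks interleave. *)

Require Import Defs.
From mathcomp Require Import all_boot all_order all_algebra.
From mathcomp Require Import reals boolp.
From mathcomp Require Import ring lra zify.

Set Implicit Arguments.
Unset Strict Implicit.
Unset Printing Implicit Defensive.

Import Order.TTheory GRing.Theory Num.Theory.

(** * Orientation of triples of vertices in convex position *)

Section ConvexPosition.
Local Open Scope ring_scope.
Variables (R : realType) (n : nat) (p : 'I_n -> 'rV[R]_2).
Hypothesis hp : convex_polygon p.

Let X i := p i ord0 ord0.
Let Y i := p i ord0 ord_max.

(** Twice the signed area of the triangle [abc], positive when it is traversed counterclockwise. *)
Definition orient (a b c : 'I_n) : R :=
  (p b ord0 ord0 - p a ord0 ord0) * (p c ord0 ord_max - p a ord0 ord_max) -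
  (p c ord0 ord0 - p a ord0 ord0) * (p b ord0 ord_max - p a ord0 ord_max).

Lemma rV2P (u v : 'rV[R]_2) :
  u ord0 ord0 = v ord0 ord0 -> u ord0 ord_max = v ord0 ord_max -> u = v.
Proof.
move=> h0 h1; apply/rowP => -[[|[|//]] lti].
  by rewrite (_ : Ordinal lti = ord0) //; apply: val_inj.
by rewrite (_ : Ordinal lti = ord_max) //; apply: val_inj.
Qed.

Lemma sum_pick (V : lmodType R) (u : 'I_n) (c : R) (F : 'I_n -> V) :
  \sum_i (c * (i == u)%:R) *: F i = c *: F u.
Proof.
rewrite (bigD1 u) //= eqxx mulr1 big1 ?addr0 // => i /negPf ->.
by rewrite mulr0 scale0r.
Qed.

Lemma sum_indic (u : 'I_n) (c : R) : \sum_i c * (i == u)%:R = c.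
Proof.
rewrite (bigD1 u) //= eqxx mulr1 big1 ?addr0 // => i /negPf ->.
by rewrite mulr0.
Qed.

Lemma in_hull3 (A : {set 'I_n}) (u v w : 'I_n) (a b c : R) :
  u \in A -> v \in A -> w \in A -> 0 <= a -> 0 <= b -> 0 <= c ->
  a + b + c = 1 -> in_hull p A (a *: p u + b *: p v + c *: p w).
Proof.
move=> uA vA wA a0 b0 c0 s1.
exists (fun i => a * (i == u)%:R + b * (i == v)%:R + c * (i == w)%:R); split.
- by move=> i; rewrite !addr_ge0 ?mulr_ge0.
- move=> i iA; have neq z : z \in A -> (i == z) = false.
    by move=> zA; apply/eqP => iz; rewrite iz zA in iA.
  by rewrite !neq // !mulr0 !addr0.
- by rewrite !big_split /= !sum_indic.
- under eq_bigr do rewrite !scalerDl.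
  by rewrite !big_split /= !sum_pick.
Qed.

Lemma in_hull2P (u v : 'I_n) (x : 'rV[R]_2) : u != v ->
  in_hull p [set u; v] x <->
  exists a b : R, [/\ 0 <= a, 0 <= b, a + b = 1 & x = a *: p u + b *: p v].
Proof.
move=> uv; split.
  case=> w [w0 wA w1 ->]; exists (w u), (w v).
  have out i : i != u -> i != v -> w i = 0.
    by move=> iu iv; apply: wA; rewrite !inE negb_or iu.
  split=> //.
  - rewrite -w1 (bigD1 u) //= (bigD1 v) 1?eq_sym //= big1 ?addr0 // => i.
    by case/andP=> iu iv; apply: out.
  - rewrite (bigD1 u) //= (bigD1 v) 1?eq_sym //= big1 ?addr0 // => i.
    by case/andP=> iu iv; rewrite out // scale0r.
case=> a [b [a0 b0 ab ->]].
have := @in_hull3 [set u; v] u v v a b 0.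
by rewrite scale0r !addr0 !inE !eqxx /= orbT; apply.
Qed.

(** The weights are not normalised and [u], [v], [w] may coincide, so that areas and inner products
    can serve as weights and segments count as degenerate triangles. *)
Lemma extreme_vertex (i u v w : 'I_n) (a b c : R) :
  i != u -> i != v -> i != w -> 0 <= a -> 0 <= b -> 0 <= c -> 0 < a + b + c ->
  (a + b + c) *: p i = a *: p u + b *: p v + c *: p w -> False.
Proof.
move=> iu iv iw a0 b0 c0 s0 e; set s := a + b + c in s0 e.
have sn : s != 0 by rewrite gt_eqF.
case: hp => _ /(_ i); apply.
have -> : p i = (a / s) *: p u + (b / s) *: p v + (c / s) *: p w.
  apply: (scalerI sn); rewrite e !scalerDr !scalerA.
  by rewrite !(mulrC s) !divfK.
apply: in_hull3; rewrite ?inE 1?eq_sym // ?divr_ge0 ?(ltW s0) //.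
by rewrite -!mulrDl divff.
Qed.

Lemma extreme_coord (i u v w : 'I_n) (a b c : R) :
  i != u -> i != v -> i != w -> 0 <= a -> 0 <= b -> 0 <= c -> 0 < a + b + c ->
  (a + b + c) * X i = a * X u + b * X v + c * X w ->
  (a + b + c) * Y i = a * Y u + b * Y v + c * Y w -> False.
Proof.
move=> iu iv iw a0 b0 c0 s0 ex ey.
by apply: (extreme_vertex iu iv iw a0 b0 c0 s0); apply: rV2P; rewrite !mxE.
Qed.

Lemma vertex_dist_gt0 (u v : 'I_n) : u != v ->
  0 < (X u - X v) ^+ 2 + (Y u - Y v) ^+ 2.
Proof.
move=> uv; rewrite lt_neqAle addr_ge0 ?sqr_ge0 // andbT eq_sym.
rewrite paddr_eq0 ?sqr_ge0 // !sqrf_eq0 !subr_eq0; apply/negP => /andP[/eqP ex /eqP ey].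
by apply: (@extreme_coord u v v v 1 0 0); rewrite ?ler01 ?lexx //; lra.
Qed.

(* For collinear [u], [v], [w] the inner product of [v - u] and [w - u] tells
   which of the three points lies between the other two. *)
Lemma orient_neq0 (u v w : 'I_n) : u != v -> u != w -> v != w ->
  orient u v w != 0.
Proof.
move=> uv uw vw; apply/eqP; set o := orient u v w => o0.
have A0 := vertex_dist_gt0 uv; have B0 := vertex_dist_gt0 uw.
pose A := (X u - X v) ^+ 2 + (Y u - Y v) ^+ 2; rewrite -/A in A0.
pose B := (X u - X w) ^+ 2 + (Y u - Y w) ^+ 2; rewrite -/B in B0.
pose d := (X v - X u) * (X w - X u) + (Y v - Y u) * (Y w - Y u).
have eA1 : d * (X v - X u) = A * (X w - X u).
  by apply: subr0_eq; transitivity ((Y v - Y u) * o); [rewrite /d /A /o /orient /X /Y;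
    ring | rewrite o0 mulr0].
have eA2 : d * (Y v - Y u) = A * (Y w - Y u).
  by apply: subr0_eq; transitivity (- (X v - X u) * o);
    [rewrite /d /A /o /orient /X /Y; ring | rewrite o0 mulr0].
have eB1 : d * (X w - X u) = B * (X v - X u).
  by apply: subr0_eq; transitivity (- (Y w - Y u) * o);
    [rewrite /d /B /o /orient /X /Y; ring | rewrite o0 mulr0].
have eB2 : d * (Y w - Y u) = B * (Y v - Y u).
  by apply: subr0_eq; transitivity ((X w - X u) * o); [rewrite /d /B /o /orient /X /Y;
    ring | rewrite o0 mulr0].
have eAB : A * B = d * d.
  by apply: subr0_eq; transitivity (o * o); [rewrite /d /A /B /o /orient /X /Y;
    ring | rewrite o0 mulr0].
(* The middle point is [u] if [d <= 0], [w] if [0 < d <= A], and [v] if [A < d]; in the last case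
   [A * B = d * d] forces [d <= B]. *)
have [d0|d0] := lerP d 0.
  by apply: (@extreme_coord u v w w B (- d) 0) => //; lra.
have [dA|dA] := lerP d A.
  by apply: (@extreme_coord w u v v (A - d) d 0); rewrite // 1?eq_sym //; lra.
have dB : d <= B by rewrite leNgt; apply/negP => Bd; nra.
by apply: (@extreme_coord v u w w (B - d) d 0); rewrite // 1?eq_sym //; lra.
Qed.

Lemma orient_rot (u v w : 'I_n) : orient u v w = orient v w u.
Proof. by rewrite /orient; ring. Qed.

Lemma orient_swap (u v w : 'I_n) : orient u w v = - orient u v w.
Proof. by rewrite /orient; ring. Qed.

Lemma orient_neq (u v w : 'I_n) : 0 < orient u v w -> [/\ u != v, u != w & v != w].
Proof.
by move=> h; split; apply: contraTneq h => ->; rewrite -leNgt /orient;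
  rewrite le_eqVlt; apply/orP; left; apply/eqP; ring.
Qed.

(** Otherwise the three turns wind around [o], which would lie in the triangle [uvw] with the areas
    opposite to the vertices as barycentric weights. *)
Lemma orient_trans (o u v w : 'I_n) : u != w ->
  0 < orient o u v -> 0 < orient o v w -> 0 < orient o u w.
Proof.
move=> uw ouv ovw; have [ou ov uv] := orient_neq ouv; have [_ ow vw] := orient_neq ovw.
have := orient_neq0 ou ow uw; case: ltrgt0P => // ouw _; exfalso.
apply: (@extreme_coord o u v w (orient o v w) (- orient o u w) (orient o u v)) => //;
  try lra;
  rewrite /orient /X /Y; ring.
Qed.

(** Otherwise [v] would lie in the triangle [ouw], again with areas as weights. *)
Lemma orient_fan (o u v w : 'I_n) :
  0 < orient o u v -> 0 < orient o v w -> 0 < orient o u w -> 0 < orient u v w.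
Proof.
move=> ouv ovw ouw.
have [ou ov uv] := orient_neq ouv; have [_ ow vw] := orient_neq ovw.
have [_ _ uw] := orient_neq ouw.
have := orient_neq0 uv uw vw; case: ltrgt0P => // uvw _; exfalso.
apply: (@extreme_coord v o u w (- orient u v w) (orient o v w) (orient o u v));
  rewrite // 1?eq_sym //; try lra;
  rewrite /orient /X /Y; ring.
Qed.

(** * The angular order around a vertex *)

Variable o : 'I_n.

(** The vertex [o] comes first, the others follow counterclockwise as seen from [o]. This is a
    linear order because [o] is extreme. *)
Definition before (u v : 'I_n) : bool :=
  if u == o then v != o else (v != o) && (0 < orient o u v).

Lemma before_irr u : before u u = false.
Proof.
rewrite /before; case: eqP => //= _.
by apply/negP => /orient_neq[_ _]; rewrite eqxx.
Qed.

Lemma before_trans : transitive before.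
Proof.
move=> v u w; rewrite /before.
have [_|uo] := eqVneq u o; first by case: (eqVneq v o) => // _ _ /andP[].
have [_|vo] := eqVneq v o; first by [].
move=> /= h1 /andP[wo h2]; rewrite wo /=; apply: (orient_trans _ h1 h2).
apply/eqP => uw; move: h1; rewrite uw (orient_swap o v w) oppr_gt0.
by rewrite ltNge (ltW h2).
Qed.

Lemma before_total u v : u != v -> before u v || before v u.
Proof.
rewrite /before => uv; have [eu|uo] := eqVneq u o; first by rewrite -eu eq_sym uv.
have [//|vo] := eqVneq v o => /=.
rewrite (orient_swap o u v) oppr_gt0 -neq_lt eq_sym orient_neq0 // eq_sym //.
Qed.

Lemma before_orient u v w : before u v -> before v w -> 0 < orient u v w.
Proof.
move=> uv vw; have uw := before_trans uv vw.
move: uv vw uw; rewrite /before.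
have [->|uo] := eqVneq u o; first by case: (eqVneq v o) => // _ _ /andP[].
have [//|vo] := eqVneq v o => /= h1 /andP[wo h2]; rewrite wo /= => h3.
exact: orient_fan h1 h2 h3.
Qed.

Definition vrank (u : 'I_n) : nat := #|[set v | before v u]|.

Lemma before_vrank u v : before u v -> (vrank u < vrank v)%N.
Proof.
move=> uv; apply: proper_card; apply/properP; split.
  by apply/subsetP => w; rewrite !inE => /before_trans; apply.
by exists u; rewrite !inE ?before_irr.
Qed.

Lemma vrank_ltn u v : (vrank u < vrank v)%N = before u v.
Proof.
apply/idP/idP => [h|]; last exact: before_vrank.
have /before_total/orP[//|/before_vrank] : u != v by apply: contraTneq h => ->;
  rewrite ltnn.
by rewrite ltnNge (ltnW h).
Qed.

Lemma vrank_inj : injective vrank.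
Proof.
move=> u v e; apply/eqP/negPn/negP => /before_total.
by rewrite -!vrank_ltn e ltnn.
Qed.

Lemma vrank_min u : (vrank o <= vrank u)%N.
Proof. by rewrite leqNgt vrank_ltn /before eqxx; case: eqP. Qed.

(** The order around [o] is thus the cyclic order of the whole polygon, cut open at [o]. *)
Lemma vrank_orient u v w : (vrank u < vrank v)%N -> (vrank v < vrank w)%N ->
  0 < orient u v w.
Proof. by rewrite !vrank_ltn; apply: before_orient. Qed.

(** * Crossing as interleaving of ranks *)

Lemma cross_sym (e f : {set 'I_n}) : cross p e f -> cross p f e.
Proof. by case=> d [x [h1 h2]]; split; [rewrite disjoint_sym | exists x]. Qed.

Lemma interleave_cross x y z w :
  (vrank x < vrank z)%N -> (vrank z < vrank y)%N -> (vrank y < vrank w)%N ->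
  cross p [set x; y] [set z; w].
Proof.
move=> xz zy yw.
have neq u v : (vrank u < vrank v)%N -> u != v by apply: contraTneq => ->; rewrite ltnn.
have xy := neq _ _ (ltn_trans xz zy); have zw := neq _ _ (ltn_trans zy yw).
split.
  rewrite disjoints_subset; apply/subsetP => i; rewrite !inE.
  case/orP => /eqP ->; rewrite negb_or.
    by rewrite (neq _ _ xz) (neq _ _ (ltn_trans (ltn_trans xz zy) yw)).
  by rewrite eq_sym (neq _ _ zy) (neq _ _ yw).
(* In the quadrilateral [xzyw] each diagonal divides the other in the ratio of the areas of the
   triangles it cuts off. Both [a + b] and [c + d] are twice the total area. *)
have a0 := vrank_orient zy yw; have b0 := vrank_orient xz (ltn_trans zy yw).
have c0 := vrank_orient (ltn_trans xz zy) yw; have d0 := vrank_orient xz zy.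
set a := orient z y w in a0; set b := orient x z w in b0.
set c := orient x y w in c0; set d := orient x z y in d0.
have e : a + b = c + d by rewrite /a /b /c /d /orient; ring.
pose s := a + b; have s0 : 0 < s by rewrite /s; lra.
exists ((a / s) *: p x + (b / s) *: p y); split; apply/in_hull2P => //.
  exists (a / s), (b / s); split=> //; rewrite ?divr_ge0 ?(ltW s0) ?(ltW a0) ?(ltW b0) //.
  by rewrite -mulrDl divff // gt_eqF.
exists (c / s), (d / s); split=> //; rewrite ?divr_ge0 ?(ltW s0) ?(ltW c0) ?(ltW d0) //.
  by rewrite -mulrDl -e divff // gt_eqF.
apply: (@scalerI _ _ s); first by rewrite gt_eqF.
rewrite !scalerDr !scalerA !(mulrC s) !divfK ?gt_eqF //.
by apply: rV2P; rewrite !mxE /a /b /c /d /orient; ring.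
Qed.

Lemma same_side_not_cross x y z w : x != y -> z != w ->
  0 < orient x y z * orient x y w -> ~ cross p [set x; y] [set z; w].
Proof.
move=> xy zw h [_ [m []]].
move=> /(in_hull2P _ xy)[a [b [a0 b0 ab ->]]] /(in_hull2P _ zw)[c [d [c0 d0 cd e]]].
have e0 : a * X x + b * X y = c * X z + d * X w.
  by move/rowP/(_ ord0): e; rewrite !mxE.
have e1 : a * Y x + b * Y y = c * Y z + d * Y w.
  by move/rowP/(_ ord_max): e; rewrite !mxE.
(* [orient x y] extends to an affine function that vanishes on the line [xy], hence at the common
   point; two values of the same sign cannot average to zero. *)
have key : c * orient x y z + d * orient x y w = 0.
  have -> : c * orient x y z + d * orient x y w =
     (X y - X x) * (c * Y z + d * Y w - (c + d) * Y x)
     - (c * X z + d * X w - (c + d) * X x) * (Y y - Y x).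
    by rewrite /orient /X /Y; ring.
  by rewrite -e0 -e1 cd -ab; ring.
have [h1|h1] : 0 < orient x y z /\ 0 < orient x y w \/ orient x y z < 0 /\ orient x y w
  < 0.
  by case: (ltrgt0P (orient x y z)) h => ?; case: (ltrgt0P (orient x y w)) => ?; nra.
all: nra.
Qed.

Lemma cross_interleave x y z w : (vrank x < vrank y)%N -> (vrank z < vrank w)%N ->
  cross p [set x; y] [set z; w] ->
  ((vrank x < vrank z) && (vrank z < vrank y) && (vrank y < vrank w) ||
  (vrank z < vrank x) && (vrank x < vrank w) && (vrank w < vrank y))%N.
Proof.
move=> xy zw cr.
have neq u v : u \in [set x; y] -> v \in [set z; w] -> vrank u != vrank v.
  move=> ux vz; case: cr => /pred0P/(_ u) /= + _; rewrite ux /=.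
  by move=> uz; apply/negP => /eqP/vrank_inj uv; rewrite uv vz in uz.
have xz := neq x z; have xw := neq x w; have yz := neq y z; have yw := neq y w.
rewrite !inE !eqxx ?orbT /= in xz xw yz yw.
move: (xz isT isT) (xw isT isT) (yz isT isT) (yw isT isT) => {neq}{}xz {}xw {}yz {}yw.
have nxy : x != y by apply: contraTneq xy => ->; rewrite ltnn.
have nzw : z != w by apply: contraTneq zw => ->; rewrite ltnn.
apply/negPn/negP => nint; apply: (@same_side_not_cross x y z w) => //.
(* The side of the line [xy] on which a vertex lies is read off from its rank, so without
   interleaving [z] and [w] are on the same side. *)
have pos u : (vrank u < vrank x)%N || (vrank y < vrank u)%N -> 0 < orient x y u.
  by case/orP => h; [rewrite -orient_rot; apply: vrank_orient | apply: vrank_orient].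
have neg u : (vrank x < vrank u)%N && (vrank u < vrank y)%N -> orient x y u < 0.
  by case/andP => h h'; rewrite orient_swap oppr_lt0; apply: vrank_orient.
have [h|h] : (((vrank z < vrank x) || (vrank y < vrank z)) && ((vrank w < vrank x) ||
  (vrank y < vrank w)))%N \/
 (((vrank x < vrank z) && (vrank z < vrank y)) && ((vrank x < vrank w) &&
   (vrank w < vrank y)))%N by lia.
  by case/andP: h => /pos ? /pos ?; apply: mulr_gt0.
by case/andP: h => /neg ? /neg ?; nra.
Qed.
End ConvexPosition.

(** * Flips preserve triangulations *)

Section Flips.
Variables (R : realType) (n : nat) (p : 'I_n -> 'rV[R]_2).
Hypothesis hp : convex_polygon p.

(** Reduces crossing to arithmetic of ranks, with a base vertex [o] that can be chosen to suit each
    use. *)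
Lemma crossE (o x y z w : 'I_n) : let r := vrank p o in
  r x < r y -> r z < r w ->
  cross p [set x; y] [set z; w] <->
  (r x < r z) && (r z < r y) && (r y < r w) || (r z < r x) && (r x < r w) && (r w < r y).
Proof.
move=> r xy zw; split; first exact: cross_interleave.
case/orP => /andP[/andP[h1 h2] h3]; first exact: (interleave_cross hp h1 h2 h3).
exact/cross_sym/(interleave_cross hp h1 h2 h3).
Qed.

Lemma edge_sorted (o : 'I_n) (e : {set 'I_n}) : is_edge e ->
  exists x y, vrank p o x < vrank p o y /\ e = [set x; y].
Proof.
move/eqP/cards2P => [x [y [xy ->]]].
case: (ltngtP (vrank p o x) (vrank p o y)) => h; first by exists x, y.
  by exists y, x; rewrite setUC.
by move/(vrank_inj hp): h xy => ->; rewrite eqxx.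
Qed.

Lemma cross_share (x y z : 'I_n) : ~ cross p [set x; y] [set x; z].
Proof. by case=> /pred0P/(_ x) /=; rewrite !inE eqxx. Qed.

Lemma cross_irr (e : {set 'I_n}) : is_edge e -> ~ cross p e e.
Proof. by move/eqP/cards2P => [x [y [xy ->]]]; apply: cross_share. Qed.

(** An edge crossing [bd] has an endpoint on each side of it. An endpoint other than [a] or [c] lies
    beyond a side of the quadrilateral, which the edge would cross on its way there. *)
Lemma edge_crossing_diagonal (a b c d : 'I_n) (g : {set 'I_n}) :
  uniq [:: a; b; c; d] ->
  cross p [set a; c] [set b; d] -> is_edge g -> cross p g [set b; d] ->
  ~ cross p g [set a; b] -> ~ cross p g [set b; c] ->
  ~ cross p g [set c; d] -> ~ cross p g [set d; a] -> g = [set a; c].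
Proof.
pose r := vrank p a.
have min := vrank_min hp a; have inj := @vrank_inj _ _ _ hp a; rewrite -/r in min inj.
have cE x y z w := @crossE a x y z w; rewrite -/r /= in cE.
have neq x y : x != y -> r x != r y by apply: contraNneq => /inj ->.
move=> uq ac /(edge_sorted a)[x [y [xy ->]]]; rewrite -/r in xy.
(* Reversing the quadrilateral exchanges [b] and [d]. As [a] has the least rank, the ranks of [a],
   [b], [c], [d] then increase. *)
wlog bd : b d uq ac / r b < r d.
  move=> wl; case: (ltngtP (r b) (r d)) => h; first exact: wl.
    rewrite [[set b; d]]setUC [[set a; b]]setUC [[set b; c]]setUC.
    rewrite [[set c; d]]setUC [[set d; a]]setUC.
    move=> h0 h1 h2 h3 h4; apply: (wl d b) => //; last by rewrite [[set d; b]]setUC.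
    by rewrite -[uniq _]/(uniq (rot 3 (rev [:: a; b; c; d]))) rot_uniq rev_uniq.
  by move: uq => /=; rewrite (inj _ _ h) !inE eqxx !(orbT, andbF).
move: uq; rewrite /= !inE !negb_or
  => /and4P[/and3P[/neq ab /neq nac /neq ad] /andP[/neq bc _] /neq cd _].
have := min b; have := min c; have := min d; have := min x => mx md mc mb.
have ltab : r a < r b by lia.
have ltad : r a < r d by lia.
have ltac : r a < r c by lia.
move/(cE _ _ _ _ ltac bd): ac => ac.
have ltbc : r b < r c by lia.
have ltcd : r c < r d by lia.
rewrite (setUC [set d]) !cE // => /orP[] /andP[/andP[h1 h2] h3].
  move=> /negP hab /negP hbc /negP hcd _.
  have xa : r x = r a by clear -hab mx h1 h2; lia.
  have yc : r y = r c by clear -hbc hcd h1 h2 h3 ltbc; lia.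
  by rewrite (inj _ _ xa) (inj _ _ yc).
by move=> _ _ _ /negP had; exfalso; clear -had h1 h2 h3 ltab; lia.
Qed.

Lemma noncrossing_flip (T T' : {set {set 'I_n}}) e f :
  noncrossing p T -> flip_edges p T e f T' -> noncrossing p T'.
Proof.
move=> [Te Tc] [a [b [c [d [uq [ee ef] crs [eT abT bcT cdT daT] ->]]]]].
have fe : is_edge f.
  by rewrite ef /is_edge cards2; move: uq; rewrite /= !inE; case: (b == d);
    rewrite ?orbT ?andbF.
have key g : g \in T -> g != e -> ~ cross p g f.
  move=> gT ge cg; move/eqP: ge; apply; rewrite ee.
  by apply: (@edge_crossing_diagonal a b c d) => //; rewrite -?ef -?ee //;
    first [exact: Te | exact: Tc].
split=> [g|g h].
  by rewrite !inE => /orP[/eqP ->|/andP[_ /Te]].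
rewrite !inE => /orP[/eqP ->|/andP[ge gT]] /orP[/eqP ->|/andP[he hT]].
- exact: cross_irr.
- by move/cross_sym; apply: key.
- exact: key.
- exact: Tc.
Qed.

(** For maximality, let [g] be an edge other than [f] in a noncrossing set containing [T']. If [g]
    crossed [e] it would be [f], by [edge_crossing_diagonal] with the diagonals exchanged; so [g]
    crosses nothing in [T] and belongs to [T]. *)
Lemma triangulation_flip (T T' : {set {set 'I_n}}) e f :
  triangulation p T -> flip_edges p T e f T' -> triangulation p T'.
Proof.
move=> [nT maxT] fl; split; first exact: noncrossing_flip fl.
case: fl => [a [b [c [d [uq [ee ef] crs [eT abT bcT cdT daT] T'E]]]]] S [Se Sc] sub.
have neq x y : ([set x; y] \in T) -> x \notin e \/ y \notin e -> [set x; y] \in S.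
  move=> h1 h2; apply: (subsetP sub); rewrite T'E !inE h1 andbT.
  apply/orP; right; apply: contraPneq h2 => <-.
  by rewrite !inE !eqxx orbT => -[].
have be : b \notin e.
  by move: uq; rewrite ee /= !inE !negb_or => /and4P[/and3P[]]; rewrite eq_sym => ->
    _ _ /andP[->].
have de : d \notin e.
  by move: uq; rewrite ee /= !inE !negb_or => /and4P[/and3P[_ _]]; rewrite eq_sym => ->
    _; rewrite eq_sym => ->.
have fS : f \in S by apply: (subsetP sub); rewrite T'E setU11.
apply/eqP; rewrite eqEsubset sub andbT; apply/subsetP => g gS.
rewrite T'E !inE; have [//|gf] /= := eqVneq g f.
have nge : ~ cross p g e.
  move=> cg; move/eqP: gf; apply; rewrite ef.
  apply: (@edge_crossing_diagonal b c d a).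
  - by move: uq; rewrite -(rot_uniq 1).
  - by rewrite [[set c; a]]setUC -ef -ee; apply: cross_sym.
  - exact: Se.
  - by rewrite [[set c; a]]setUC -ee.
  - by apply: Sc => //; apply: neq; auto.
  - by apply: Sc => //; apply: neq; auto.
  - by apply: Sc => //; apply: neq; auto.
  - by apply: Sc => //; apply: neq; auto.
have ge : g != e.
  by apply/eqP => ge; apply: (Sc g f) => //; rewrite ge.
rewrite ge /= -(maxT (g |: T)) ?setU11 ?subsetUr //.
have key h : h \in T -> ~ cross p g h.
  move=> hT; have [->//|he] := eqVneq h e.
  by apply: Sc => //; apply: (subsetP sub); rewrite T'E !inE he hT orbT.
case: nT => Te Tc; split=> [h|h k].
  by rewrite !inE => /orP[/eqP ->|]; [apply: Se | apply: Te].
rewrite !inE => /orP[/eqP ->|hT] /orP[/eqP ->|kT].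
- exact/cross_irr/Se.
- exact: key.
- by move/cross_sym; apply: key.
- exact: Tc.
Qed.
End Flips.

(** * The retraction onto edge sets containing a given edge *)

Section Retraction.
Variables (R : realType) (n : nat) (p : 'I_n -> 'rV[R]_2).
Hypothesis hp : convex_polygon p.
Variables a b : 'I_n.
Hypothesis neq_ab : a != b.

(* [comb] is the retraction onto the edge sets that contain [ab], with apex [a]. *)
Definition comb_edge (e : {set 'I_n}) : {set {set 'I_n}} :=
  if `[< cross p e [set a; b] >] then [set [set a; u] | u in e] else [set e].

Definition comb (S : {set {set 'I_n}}) : {set {set 'I_n}} :=
  [set a; b] |: \bigcup_(e in S) comb_edge e.

(** Both directions are demanded to make the relation symmetric, so that the two diagonals of a flip
    can be interchanged. *)
Definition same_or_flip (S S' : {set {set 'I_n}}) : Prop :=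
  S = S' \/ flip p S S' /\ flip p S' S.

Local Notation r := (vrank p a).

Let rank_min u : r a <= r u. Proof. exact: vrank_min. Qed.

Let rank_inj : injective r. Proof. exact: vrank_inj. Qed.

Let rank_apex u : u != a -> r a < r u.
Proof. by move=> ua; rewrite ltn_neqAle rank_min andbT (inj_eq rank_inj) eq_sym. Qed.

Let rank_ab : r a < r b. Proof. by rewrite rank_apex // eq_sym. Qed.

Lemma same_or_flip_sym S S' : same_or_flip S S' -> same_or_flip S' S.
Proof. by case=> [->|[h1 h2]]; [left | right]. Qed.

Lemma combU1 e S : comb (e |: S) = comb_edge e :|: comb S.
Proof. by rewrite /comb bigcup_setU big_set1 setUCA. Qed.

Lemma mem_comb e (S : {set {set 'I_n}}) g : e \in S -> g \in comb_edge e -> g \in comb S.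
Proof. by move=> eS ge; rewrite /comb inE; apply/orP; right; apply/bigcupP; exists e. Qed.

Lemma mem_comb_ab S : [set a; b] \in comb S.
Proof. exact: setU11. Qed.

Lemma comb_edge_cross x y : r a < r x -> r x < r b -> r b < r y ->
  comb_edge [set x; y] = [set [set a; x]; [set a; y]].
Proof.
move=> ax xb bY; rewrite /comb_edge asboolT; first by rewrite imsetU1 imset_set1.
by apply/(crossE hp _ rank_ab); lia.
Qed.

Lemma comb_edge_id x y : r x < r y -> (r x <= r a) || (r b <= r x) || (r y <= r b) ->
  comb_edge [set x; y] = [set [set x; y]].
Proof.
move=> xy h; rewrite /comb_edge asboolF // => /(crossE hp xy rank_ab).
have := rank_min x; lia.
Qed.

Lemma comb_elt (S : {set {set 'I_n}}) g : (forall e, e \in S -> is_edge e) ->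
  g \in comb S ->
  (g \in S /\ ~ cross p g [set a; b]) \/
  exists u, [/\ r a < r u, g = [set a; u] & u = b \/
    exists v, [set u; v] \in S /\
      ((r a < r u) && (r u < r b) && (r b < r v) || (r a < r v) && (r v < r b) &&
        (r b < r u))].
Proof.
move=> Se; rewrite /comb inE => /orP[|/bigcupP[e eS]].
  by rewrite inE => /eqP ->; right; exists b; split; auto.
have [x [y [xy ee]]] := edge_sorted hp a (Se _ eS); rewrite ee in eS *.
rewrite /comb_edge; case: asboolP => [|nc].
  move/(crossE hp xy rank_ab) => h.
  have {}h : (r a < r x) && (r x < r b) && (r b < r y) by have := rank_min x; lia.
  rewrite imsetU1 imset_set1 !inE => /orP[] /eqP ->; right.
    by exists x; split=> //; [lia | right; exists y; rewrite eS; split=> //; lia].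
  by exists y; split=> //; [lia | right; exists x; rewrite setUC eS; split=> //; lia].
by rewrite inE => /eqP ->; left.
Qed.

Lemma noncrossing_comb (S : {set {set 'I_n}}) : noncrossing p S -> noncrossing p (comb S).
Proof.
move=> [Se Sc].
have nc x y z w : [set x; y] \in S -> [set z; w] \in S -> r x < r y -> r z < r w ->
    ~~ ((r x < r z) && (r z < r y) && (r y < r w)).
  by move=> xS zS xy zw; apply/negP => h; apply: (Sc _ _ xS zS);
    apply/(crossE hp xy zw); rewrite h.
(* A spoke [au] other than [ab] stems from an edge [uv] crossing [ab]. If [g] crosses [au], it
   separates [a] from [u], so it crosses the path that follows [ab] up to [uv] and then [uv] to [u];
   thus it crosses [ab] or [uv]. *)
have key g u : g \in S -> ~ cross p g [set a; b] -> r a < r u ->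
    (u = b \/ exists v, [set u; v] \in S /\
      ((r a < r u) && (r u < r b) && (r b < r v) || (r a < r v) && (r v < r b) &&
        (r b < r u))) ->
    ~ cross p g [set a; u].
  move=> gS; have [x [y [xy eg]]] := edge_sorted hp a (Se _ gS); rewrite eg in gS *.
  move=> gab au [->//|[v [uS h]]] /(crossE hp xy au) h'.
  apply: gab; apply/(crossE hp xy rank_ab).
  have := rank_min x; have := rank_min y => my mx.
  case/orP: h => h.
    have uv : r u < r v by lia.
    by have := nc _ _ _ _ gS uS xy uv; have := nc _ _ _ _ uS gS uv xy; lia.
  have uv : r v < r u by lia.
  rewrite setUC in uS.
  by have := nc _ _ _ _ gS uS xy uv; have := nc _ _ _ _ uS gS uv xy; lia.
split=> [g /(comb_elt Se)[[/Se //]|[u [au -> _]]]|g h].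
  by rewrite /is_edge cards2; case: eqP au => // ->; rewrite ltnn.
move=> /(comb_elt Se)[[gS gab]|[u [au -> hu]]] /(comb_elt Se)[[hS hab]|[w [aw -> hw]]].
- exact: Sc.
- exact: key.
- by move/cross_sym; apply: key.
- exact: cross_share.
Qed.

Lemma exchange_flip (K : {set {set 'I_n}}) w x y z : uniq [:: w; x; y; z] ->
  [set w; x] \in K -> [set x; y] \in K -> [set y; z] \in K -> [set z; w] \in K ->
  cross p [set w; y] [set x; z] -> noncrossing p ([set x; z] |: K) ->
  flip p ([set w; y] |: K) ([set x; z] |: K).
Proof.
move=> uq wx xy yz zw cr [_ nc]; exists [set w; y], [set x; z], w, x, y, z.
split=> //; first by split=> //; rewrite !inE ?eqxx ?wx ?xy ?yz ?zw ?orbT.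
rewrite setU1K //; apply/negP => wyK.
by apply: (nc [set w; y] [set x; z]); rewrite ?inE ?eqxx ?wyK ?orbT.
Qed.

Lemma exchange_same_or_flip (K : {set {set 'I_n}}) w x y z : r w < r x -> r x < r y ->
  r y < r z ->
  [set w; x] \in K -> [set x; y] \in K -> [set y; z] \in K -> [set w; z] \in K ->
  noncrossing p ([set w; y] |: K) -> noncrossing p ([set x; z] |: K) ->
  same_or_flip ([set w; y] |: K) ([set x; z] |: K).
Proof.
move=> wx xy yz wxK xyK yzK zwK nc1 nc2; right.
have neq u v : r u < r v -> u != v by apply: contraTneq => ->; rewrite ltnn.
have uq : uniq [:: w; x; y; z] by rewrite /= !inE !negb_or !neq //; lia.
have cr : cross p [set w; y] [set x; z] by apply: (interleave_cross hp wx xy yz).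
split; first by apply: exchange_flip => //; rewrite setUC.
rewrite [[set w; y]]setUC in nc1 cr *.
by apply: exchange_flip => //; [rewrite -(rot_uniq 3) | rewrite setUC | apply: cross_sym].
Qed.

(** The cases are the positions of [a] and [b] among the corners. If neither diagonal crosses [ab],
    the flip survives unchanged; if just one does, it becomes stationary when [w] is [a] and
    otherwise moves to a quadrilateral with corner [a]; if both do, it becomes stationary. *)
Lemma same_or_flip_sorted (C : {set {set 'I_n}}) w x y z : r w < r x -> r x < r y ->
  r y < r z ->
  [set w; x] \in C -> [set x; y] \in C -> [set y; z] \in C -> [set w; z] \in C ->
  noncrossing p ([set w; y] |: C) -> noncrossing p ([set x; z] |: C) ->
  same_or_flip (comb ([set w; y] |: C)) (comb ([set x; z] |: C)).
Proof.
move=> wx xy yz wxC xyC yzC wzC.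
move=> /noncrossing_comb + /noncrossing_comb; rewrite !combU1.
have mw := rank_min w.
have wy := ltn_trans wx xy; have xz := ltn_trans xy yz; have wz := ltn_trans wx xz.
have inC u v : [set u; v] \in C -> r u < r v -> (r u <= r a) || (r b <= r u) ||
  (r v <= r b) ->
    [set u; v] \in comb C.
  by move=> uvC uv h; apply: (mem_comb uvC); rewrite comb_edge_id // set11.
have apexC u v : [set u; v] \in C -> r a < r u -> r u < r b -> r b < r v ->
    [set a; u] \in comb C /\ [set a; v] \in comb C.
  by move=> uvC h1 h2 h3; split; apply: (mem_comb uvC); rewrite comb_edge_cross //
    !inE eqxx ?orbT.
have absorb (g : {set 'I_n}) : g \in comb C -> [set g] :|: comb C = comb C.
  by move=> gC; apply/setUidPr; rewrite sub1set.
have [eqwa|nwa] := eqVneq w a; last have aw := rank_apex nwa.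
  rewrite {w}eqwa in wx wy wz wxC wzC mw *.
  rewrite (comb_edge_id wy) ?leqnn //.
  (* Here [xz] falls apart into the sides [ax] and [az], while [ay] is [ab] itself or a spoke of
     whichever of [xy] and [yz] crosses [ab]. *)
  have [hb|hb] := boolP ((r x < r b) && (r b < r z)).
    case/andP: hb => xb bz ncw ncx; left.
    rewrite (comb_edge_cross wx xb bz) -setUA !absorb //; first by apply: inC;
      rewrite ?leqnn.
      by apply: inC; rewrite ?leqnn.
    case: (ltngtP (r b) (r y)) => [by_|yb|/rank_inj <-]; last exact: mem_comb_ab.
      by case: (apexC x y).
    by case: (apexC y z).
  rewrite comb_edge_id //; last by lia.
  by apply: exchange_same_or_flip => //; apply: inC => //; lia.
have ax := ltn_trans aw wx; have ay := ltn_trans aw wy; have az := ltn_trans aw wz.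
have [bw|wb] := leqP (r b) (r w).
  rewrite !comb_edge_id //; try lia.
  by apply: exchange_same_or_flip => //; apply: inC => //; lia.
have [zb|bz] := leqP (r z) (r b).
  rewrite !comb_edge_id //; try lia.
  by apply: exchange_same_or_flip => //; apply: inC => //; lia.
have [awC azC] := apexC w z wzC aw wb bz.
(* Only [wy] crosses [ab]: the flip exchanges [ay] and [xz] in the quadrilateral [axyz], whose side
   [ax] is [ab] or a spoke of [wx]. *)
have [bx|xb] := leqP (r b) (r x).
  rewrite (comb_edge_cross aw wb (leq_ltn_trans bx xy)) comb_edge_id ?bx ?orbT //
    -setUA setUCA (absorb [set a; w]) //.
  move=> ncw ncx.
  apply: exchange_same_or_flip => //; try by apply: inC => //; lia.
  case: (ltngtP (r b) (r x)) bx => [bx|//|/rank_inj <-] _; last exact: mem_comb_ab.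
  by case: (apexC w x).
(* Only [xz] crosses [ab]: the flip exchanges [wy] and [ax] in the quadrilateral [awxy], whose side
   [ay] is [ab] or a spoke of [yz]. *)
have [yb|by_] := leqP (r y) (r b).
  rewrite (comb_edge_id wy) ?yb ?orbT //
    (comb_edge_cross ax xb bz) -setUA (absorb [set a; z]) //.
  move=> ncw ncx; apply: same_or_flip_sym; apply: exchange_same_or_flip => //;
    try by apply: inC => //; lia.
  case: (ltngtP (r y) (r b)) yb => [yb|//|/rank_inj ->] _; last exact: mem_comb_ab.
  by case: (apexC y z).
(* Both diagonals cross [ab], but so do the sides [wz] and [xy], which already supply all four
   spokes. *)
move=> _ _; have [axC ayC] := apexC x y xyC ax xb by_; left.
by rewrite (comb_edge_cross aw wb by_) (comb_edge_cross ax xb bz) -!setUA !absorb.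
Qed.

Lemma comb_flip (T T' : {set {set 'I_n}}) e f :
  noncrossing p T -> flip_edges p T e f T' -> same_or_flip (comb T) (comb T').
Proof.
move=> nT fl; have nT' := noncrossing_flip hp nT fl.
case: fl => [w [x [y [z [uq [ee ef] crs [eT wxT xyT yzT zwT] T'E]]]]].
pose C := T :\ e.
have TE : T = e |: C by rewrite setD1K.
have side u v : u \in e -> v \in f -> [set u; v] \in C.
  move=> ue vf; rewrite !inE; apply/andP; split.
    case: crs => /pred0P/(_ v) /=; rewrite vf andbT => ve _.
    by apply: contraFneq ve => <-; rewrite !inE eqxx orbT.
  move: ue vf; rewrite ee ef !inE => /orP[] /eqP -> /orP[] /eqP -> //.
  - by rewrite setUC.
  - by rewrite setUC.
rewrite T'E -/C TE; rewrite T'E -/C in nT'; rewrite TE in nT.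
have [v1 [v3 [h13 e13]]] : exists u v, r u < r v /\ e = [set u; v].
  by apply: edge_sorted => //; apply: nT.1; rewrite setU11.
have [v2 [v4 [h24 f24]]] : exists u v, r u < r v /\ f = [set u; v].
  by apply: edge_sorted => //; apply: nT'.1; rewrite setU11.
have [v1e v3e] : v1 \in e /\ v3 \in e by rewrite e13 !inE !eqxx orbT.
have [v2f v4f] : v2 \in f /\ v4 \in f by rewrite f24 !inE !eqxx orbT.
have sideC u v : u \in e -> v \in f -> [set v; u] \in C by rewrite setUC; apply: side.
move: crs; rewrite {1}e13 {1}f24 => /(crossE hp h13 h24).
case/orP => /andP[/andP[h1 h2] h3].
  by rewrite e13 f24 in nT nT' *; apply: same_or_flip_sorted; auto.
by rewrite e13 f24 in nT nT' *; apply: same_or_flip_sym; apply: same_or_flip_sorted; auto.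
Qed.

Lemma comb_id (T : {set {set 'I_n}}) :
  noncrossing p T -> [set a; b] \in T -> comb T = T.
Proof.
move=> [_ nT] abT; rewrite /comb (eq_bigr (fun e => [set e])) => [|e eT]; last first.
  by rewrite /comb_edge asboolF //; apply: nT.
apply/setP => g; rewrite !inE; apply/orP/idP => [[/eqP ->//|/bigcupP[e eT]]|gT].
  by rewrite inE => /eqP ->.
by right; apply/bigcupP; exists g; rewrite ?set11.
Qed.

(** Only [e] crosses [ab] in [T], and since [a] is a corner of the quadrilateral, the spokes that
    replace [e] are two of its sides. *)
Lemma comb_introducing_flip (T T' : {set {set 'I_n}}) e :
  noncrossing p T -> flip_edges p T e [set a; b] T' -> comb T = T'.
Proof.
move=> nT fl; have nT' := noncrossing_flip hp nT fl.
case: fl => [w [x [y [z [uq [ee ef] crs [eT wxT xyT yzT zwT] T'E]]]]].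
rewrite -(setD1K eT) combU1.
have -> : comb (T :\ e) = T'.
  rewrite -[RHS](comb_id nT') T'E ?setU11 // combU1 /comb_edge asboolF;
    last exact: cross_share.
  by apply/esym/setUidPr; rewrite sub1set mem_comb_ab.
apply/setUidPr.
rewrite /comb_edge asboolT //; apply/subsetP => g /imsetP[u ue ->].
have af : a \in [set x; z] by rewrite -ef !inE eqxx.
rewrite T'E !inE; apply/orP; right; apply/andP; split.
  case: crs => /pred0P/(_ a) /= + _; rewrite !inE eqxx andbT => ae.
  by apply: contraFneq ae => <-; rewrite !inE eqxx.
move: ue af; rewrite ee !inE => /orP[] /eqP -> /orP[] /eqP -> //.
- by rewrite setUC.
- by rewrite setUC.
Qed.
End Retraction.

(** * Paths of flips and the distance bound *)

Section FlipPaths.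
Variables (R : realType) (n : nat) (p : 'I_n -> 'rV[R]_2).
Hypothesis hp : convex_polygon p.
Implicit Types (U V W : {set {set 'I_n}}) (S : nat -> {set {set 'I_n}}).

Definition joined (m : nat) U V : Prop :=
  exists S, [/\ flip_path p m S, S 0 = U & S m = V].

Lemma joined0 U : triangulation p U -> joined 0 U U.
Proof. by move=> tU; exists (fun=> U); split. Qed.

Lemma joined_rcons m U V W : joined m U V -> flip p V W -> joined m.+1 U W.
Proof.
case=> S [[St Sf] S0 Sm] [e [f fl]].
have tW : triangulation p W.
  by apply: (triangulation_flip hp _ fl); rewrite -Sm; apply: St.
exists (fun i => if i <= m then S i else W); split; rewrite ?ltnn //; split.
  by move=> i _; case: leqP => // /St.
move=> i; rewrite ltnS => im; rewrite im.
case: (ltngtP i m) im => [im _|//|-> _]; first exact: Sf.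
by rewrite Sm; exists e, f.
Qed.

Lemma joined_trans m l U V W : joined m U V -> joined l V W -> joined (m + l) U W.
Proof.
move=> jUV [S [[_ Sf] S0 <-]].
suff: forall i, i <= l -> joined (m + i) U (S i) by apply.
elim=> [_|i IH il]; first by rewrite addn0 S0.
by rewrite addnS; apply: joined_rcons (IH (ltnW il)) (Sf i il).
Qed.

Lemma joined_segment k S i j : flip_path p k S -> i <= j -> j <= k ->
  joined (j - i) (S i) (S j).
Proof.
move=> [St Sf] ij jk; exists (fun t => S (i + t)); split; last 2 first.
- by rewrite addn0.
- by rewrite subnKC.
by split=> t ht; rewrite ?addnS; [apply: St | apply: Sf]; lia.
Qed.

(* The retraction [comb] maps the given path onto one from [U'] to [V], on
   which the step that introduces [f] becomes stationary. *)
Lemma joined_toward m U V U' e f : joined m U V -> flip_edges p U e f U' ->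
  f \in V -> exists2 m', m' < m & joined m' U' V.
Proof.
case=> S [[St Sf] S0 Sm] fl fV.
have tU' : triangulation p U' by apply: (triangulation_flip hp _ fl); rewrite -S0;
  apply: St.
have [a [b [neq_ab fE]]] : exists a b, a != b /\ f = [set a; b].
  case: fl => [w [x [y [z [uq [_ ->] _ _ _]]]]]; exists x, z; split=> //.
  by move: uq; rewrite /= !inE !negb_or => /and4P[_ /andP[_ ->]].
rewrite {f}fE in fl fV.
(* The saved step is claimed only where [ab] is present. At the start the claim is vacuous, since
   [U] contains [e], which crosses [ab]. *)
suff path i : i <= m -> exists m', [/\ m' <= i, [set a; b] \in S i -> m' < i
    & joined m' U' (comb p a b (S i))].
  have [m' [_ lt]] := path m (leqnn m); rewrite Sm comb_id //;
    last by case: (St m (leqnn m)); rewrite Sm.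
  by exists m' => //; apply: lt; rewrite Sm.
elim: i => [_|i IH im].
  exists 0; split=> //.
    move=> ab; case: (St 0 isT) => -[_ nc] _; exfalso.
    case: fl => [w [x [y [z [_ _ crs [eU _ _ _ _] _]]]]].
    by apply: (nc e [set a; b]) => //; rewrite S0.
  rewrite (@comb_introducing_flip _ _ _ hp _ _ (S 0) U' e); first exact: joined0.
    by case: (St 0 isT).
  by rewrite S0.
have [m' [m'i lt jm]] := IH (ltnW im).
have [nSi _] := St i (ltnW im); have [nSi1 _] := St i.+1 im.
have [e' [f' fl']] := Sf i im.
have [ef'|f'ab] := eqVneq f' [set a; b].
  rewrite {f'}ef' in fl'; exists m'; split; [exact: leqW|by []|].
  rewrite comb_id //; last by case: fl' => [? [? [? [? [_ _ _ _ ->]]]]]; rewrite setU11.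
  by rewrite -(comb_introducing_flip hp nSi fl').
(* A flip introducing another edge cannot create [ab], so the step was already saved before it. *)
have abS : [set a; b] \in S i.+1 -> m' < i.
  case: (fl') => [? [? [? [? [_ _ _ _ ->]]]]]; rewrite !inE eq_sym (negPf f'ab) /=.
  by case/andP=> _ /lt.
case: (comb_flip hp neq_ab nSi fl') => [<-|[fl2 _]].
  by exists m'; split; [exact: leqW | move/abS; exact: leqW |].
by exists m'.+1; split=> //; apply: joined_rcons fl2.
Qed.

End FlipPaths.

(** Each flip of [T'] comes one step closer to [T j]; continuing along [T] bounds the distance from
    [T' l] to [T k] above. A shorter path, preceded by [T'], would contradict that [T] is
    geodesic. *)
Theorem theorem2 (R : realType) (n : nat) (p : 'I_n -> 'rV[R]_2)
    (hp : convex_polygon p)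
    (k l : nat) (T T' : nat -> {set {set 'I_n}})
    (hT : geodesic p k T) (hT' : flip_path p l T') (h0 : T 0 = T' 0)
    (j : nat) (hj : j <= k)
    (hintro : forall f : {set 'I_n}, introduced_along p l T' f -> f \in T j) :
  l <= k /\ flip_distance p (T' l) (T k) (k - l).
Proof.
case: hT => pT minT.
have minJ m : joined p m (T 0) (T k) -> k <= m by case=> S [pS S0 Sm]; apply: minT S0 Sm.
(* Stated with a sum, since truncated subtraction would lose [i <= j], which yields [l <= k]. *)
have approach i : i <= l -> exists2 m, m + i <= j & joined p m (T' i) (T j).
  elim: i => [_|i IH il].
    exists j; rewrite ?addn0 // -h0.
    by have := joined_segment pT (leq0n j) hj; rewrite subn0.
  have [m mi jm] := IH (ltnW il).
  case: hT' => _ /(_ i il)[e [f fl]].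
  have fT : f \in T j by apply: hintro; exists i; split=> //; exists e.
  by have [m' m'm jm'] := joined_toward hp jm fl fT; exists m' => //; lia.
have [m ml jm] := approach l (leqnn l).
have jmk := joined_trans hp jm (joined_segment pT hj (leqnn k)).
have j0l : joined p l (T 0) (T' l).
  by rewrite h0; have := joined_segment hT' (leq0n l) (leqnn l); rewrite subn0.
have far m' : joined p m' (T' l) (T k) -> k <= l + m'.
  by move=> jm'; apply: minJ; apply: joined_trans j0l jm'.
have dE : k - l = m + (k - j) by have := far _ jmk; lia.
split; first by lia.
case: jmk => S [pS S0 Sm]; exists S; rewrite dE; split=> //; split=> // m' S' pS' S'0 S'm.
have : k <= l + m' by apply: far; exists S'; split=> //; rewrite ?S'0 ?S'm.
lia.
Qed.
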